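(* Let $G$ be a graph such that both $G$ and its complement $\overline{G}$ are connected and neither is a tree. Let $m$ and $\overline{m}$ be the numbers of edges and $\lambda$ and $\overline{\lambda}$ the edge-connectivities of $G$ and $\overline{G}$, respectively, and let $w$ and $\overline{w}$ be normalised weight functions on $E(G)$ and $E(\overline{G})$, respectively. Then $$0\leq \mathrm{avec}(G,w)+\mathrm{avec}(\overline{G},\overline{w})\leq \frac{m}{\lambda}+\frac{\overline{m}}{\overline{\lambda}}$$ and $$0\leq \mathrm{avec}(G,w)\,\mathrm{avec}(\overline{G},\overline{w})\leq \frac{m\,\overline{m}}{\lambda\,\overline{\lambda}}.$$
   Context: Graphs are finite and simple. For a connected graph $H$ with $n$ vertices and $m$ edges, a weight function is a map $w:E(H)\to\mathbb{R}^{\geq 0}$; it is called normalised if $\sum_{e\in E(H)}w(e)=m$. The weighted distance $d_w(u,v)$ is the minimum, over all paths between $u$ and $v$ in $H$, of the sum of the weights of the edges of the path. The weighted eccentricity of a vertex $v$ is $e_w(v)=\max_{u\in V(H)}d_w(u,v)$, and the average eccentricity is $\mathrm{avec}(H,w)=\frac1n\sum_{v\in V(H)}e_w(v)$. The edge-connectivity of $H$ is the smallest number of edges whose deletion disconnects $H$. The complement $\overline{G}$ of $G$ has the same vertex set as $G$, two distinct vertices being adjacent in $\overline{G}$ if and only if they are not adjacent in $G$. *)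

(* Defs.v *)
From mathcomp Require Import all_boot all_order all_algebra.
Set Implicit Arguments.
Unset Strict Implicit.
Unset Printing Implicit Defensive.
Import Order.TTheory GRing.Theory Num.Theory.
Local Open Scope ring_scope.

(* A finite simple graph is a symmetric irreflexive relation e on a finType;   *)
(* an edge is the two-element set of its endpoints.                            *)

Section Graphs.
Variables (T : finType) (e : rel T).

Definition edges : {set {set T}} :=
  [set f | [exists x, exists y, e x y && (f == [set x; y])]].

Definition complement : rel T := [rel x y | (x != y) && ~~ e x y].

Definition connected : bool :=
  (0 < #|T|)%N && [forall x, forall y, connect e x y].

(* [ucycle] alone would accept the closed walk x, y, x along a single edge.    *)
Definition acyclic : Prop :=
  forall c : seq T, (2 < size c)%N -> ~ ucycle e c.

Definition tree : Prop := connected /\ acyclic.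

Definition delete_edges (S : {set {set T}}) : rel T :=
  [rel x y | e x y && ([set x; y] \notin S)].

End Graphs.

Section EdgeConnectivity.
Variables (T : finType) (e : rel T).

Definition disconnecting (S : {set {set T}}) : bool :=
  (S \subset edges e) && ~~ connected (delete_edges e S).

(* The whole edge set is disconnecting as soon as there are two vertices; on   *)
(* one vertex no set is, and the value is 0.                                   *)
Definition edge_connectivity : nat :=
  #|[arg min_(S < edges e | disconnecting S) #|S|]|.

End EdgeConnectivity.

(* A path from u to v is a seq p listing its vertices after u. Having distinct *)
(* vertices it has length less than #|T|, so the paths can be enumerated.      *)
Section Paths.
Variables (T : finType) (e : rel T).

Definition is_path (u v : T) (p : seq T) : bool :=
  [&& path e u p, uniq (u :: p) & last u p == v].

Definition paths (u v : T) : seq (seq T) :=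
  [seq bseqval p | p : #|T|.-bseq T <- enum {: #|T|.-bseq T} & is_path u v p].

Definition path_edges (u : T) (p : seq T) : seq {set T} :=
  pairmap (fun x y => [set x; y]) u p.

Lemma mem_paths u v p : (p \in paths u v) = is_path u v p.
Proof.
apply/mapP/idP => [[q + ->]|Pp]; first by rewrite mem_filter => /andP[].
have sp : (size p <= #|T|)%N.
  case/and3P: Pp => _ /andP[_ Up] _.
  by rewrite -(card_uniqP Up) max_card.
by exists (Bseq sp); rewrite // mem_filter Pp mem_enum.
Qed.

End Paths.

(* The minimum of a nonempty list: the initial value is one of its elements.   *)
Definition seq_min (R : realDomainType) (s : seq R) : R :=
  \big[Num.min/head 0 s]_(x <- s) x.

Lemma seq_min_le (R : realDomainType) (s : seq R) x : x \in s -> seq_min s <= x.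
Proof. by move=> sx; apply: ge_bigmin_seq. Qed.

Lemma seq_min_mem (R : realDomainType) (s : seq R) : s != [::] -> seq_min s \in s.
Proof.
case: s => // a s _; rewrite /seq_min /=.
rewrite big_seq; elim/big_ind: _ => [|x y xs ys|//]; first exact: mem_head.
by rewrite minEle; case: ifP.
Qed.

(* A weight function is given on all subsets of T, but everything below uses   *)
(* its values on edges only.                                                   *)
Section Weights.
Variables (R : realFieldType) (T : finType) (e : rel T) (w : {set T} -> R).

Definition weight_function : Prop := forall f, f \in edges e -> 0 <= w f.

Definition normalised : Prop :=
  \sum_(f in edges e) w f = #|edges e|%:R.

Definition path_weight (u : T) (p : seq T) : R :=
  \sum_(f <- path_edges u p) w f.

Definition wdist (u v : T) : R :=
  seq_min [seq path_weight u p | p <- paths e u v].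

(* The initial value wdist v v is itself one of the terms.                     *)
Definition wecc (v : T) : R := \big[Num.max/wdist v v]_(u : T) wdist u v.

Definition avec : R := #|T|%:R^-1 * \sum_(v : T) wecc v.

End Weights.

(* Main.v *)
Require Import Defs.
From mathcomp Require Import all_boot all_order all_algebra.
From mathcomp Require Import reals.
From mathcomp Require Import lra.
Set Implicit Arguments.
Unset Strict Implicit.
Unset Printing Implicit Defensive.
Import Order.TTheory GRing.Theory Num.Theory.
Local Open Scope ring_scope.

(** Each of the two graphs H satisfies 0 <= avec(H, w) <= m / lambda separately,
and the corollary follows by adding and multiplying these bounds.  For the upper
bound it is enough that lambda * d_w(u, v) <= m for distinct vertices u and v;
one may then divide, since lambda > 0 for a connected graph with two vertices
([edge_connectivity_gt0]).

This is the easy half of linear programming duality between distances and cuts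
([potential_bound]).  The function x = d_w(u, -) is a potential: it is
nonnegative, vanishes at u, and varies by at most w(f) along every edge f
([wdist_step]).  For 0 < t <= x(v) the set where x < t contains u but not v, so
at least lambda edges leave it ([edge_connectivity_le_cut]).  Integrating the
number of these edges over t yields at least lambda * x(v), whereas each edge f
contributes at most w(f), so the integral is at most the total weight m.  As x
takes finitely many values, the integration is an induction that removes one
layer of x at a time. *)

Section Cuts.
Variables (T : finType) (e : rel T).

(** The edges with one endpoint in A and the other outside A. *)
Definition cut (A : {set T}) : {set {set T}} :=
  [set f in edges e | ~~ (f \subset A) && ~~ (f \subset ~: A)].

Lemma mem_edges a b : e a b -> [set a; b] \in edges e.
Proof.
by move=> eab; rewrite inE; apply/existsP; exists a; apply/existsP; exists b;
  rewrite eab eqxx.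
Qed.

Lemma edgesP f : reflect (exists a b, e a b /\ f = [set a; b]) (f \in edges e).
Proof.
rewrite inE; apply: (iffP existsP) => [[a /existsP[b /andP[eab /eqP ->]]]|].
  by exists a, b.
by case=> a [b [eab ->]]; exists a; apply/existsP; exists b; rewrite eab eqxx.
Qed.

Lemma mem_cut A a b :
  e a b -> ([set a; b] \in cut A) = ((a \in A) != (b \in A)).
Proof.
move=> eab; rewrite inE mem_edges //= !subUset !sub1set !inE.
by case: (a \in A); case: (b \in A).
Qed.

Lemma disconnecting_cut (A : {set T}) u v (S : {set {set T}}) :
  u \in A -> v \notin A -> cut A \subset S -> S \subset edges e ->
  disconnecting e S.
Proof.
move=> uA vA AS Se; rewrite /disconnecting Se /=.
apply/negP => /andP[_ /forallP/(_ u)/forallP/(_ v) uv].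
have clA : closed (delete_edges e S) (mem A).
  move=> a b /andP[eab abS]; apply/eqP/negPn.
  by rewrite -mem_cut //; apply: contra abS => /(subsetP AS).
by have := closed_connect clA uv; rewrite /= uA (negbTE vA).
Qed.

Lemma edge_connectivity_le_cut (A : {set T}) u v :
  u \in A -> v \notin A -> (edge_connectivity e <= #|cut A|)%N.
Proof.
move=> uA vA; rewrite /edge_connectivity.
have cutE : cut A \subset edges e by apply/subsetP => f; rewrite inE => /andP[].
case: arg_minnP => [|S _ minS]; first exact: (disconnecting_cut uA vA).
exact/minS/(disconnecting_cut uA vA).
Qed.

Lemma edge_connectivity_gt0 (u v : T) :
  connected e -> u != v -> (0 < edge_connectivity e)%N.
Proof.
move=> ce uv; rewrite /edge_connectivity.
have uA : u \in [set u] by rewrite inE.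
have vA : v \notin [set u] by rewrite inE eq_sym.
case: arg_minnP => [|S /andP[_ +] _].
  apply: (disconnecting_cut uA vA) => //.
  by apply/subsetP => f; rewrite inE => /andP[].
rewrite card_gt0; apply: contraNneq => ->.
have eq0 : delete_edges e set0 =2 e.
  by move=> x y; rewrite /delete_edges /= in_set0 andbT.
move: ce; rewrite /connected => /andP[-> /=] /forallP ce.
apply/forallP => x; apply/forallP => y.
by rewrite (eq_connect eq0); move/forallP: (ce x); apply.
Qed.

(** Weak duality between potentials and cuts: when every cut separating u from v
has at least k edges, a potential x that rises by D from u to v forces a total
edge weight of at least k * D. *)
Lemma potential_bound (R : realFieldType) (e_sym : symmetric e) u v (k : nat)
    (cut_ge : forall A : {set T}, u \in A -> v \notin A -> (k <= #|cut A|)%N)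
    (x : T -> R) (w : {set T} -> R) :
  (forall y, 0 <= x y) -> x u = 0 ->
  (forall a b, e a b -> x b - x a <= w [set a; b]) ->
  k%:R * x v <= \sum_(f in edges e) w f.
Proof.
have [n] := ubnP #|[set y | 0 < x y]|.
elim: n x w => // n IHn x w ltn x_ge0 xu0 xw.
have [xv_gt0|xv_le0] := ltP 0 (x v); last first.
  have -> : x v = 0 by apply/le_anti; rewrite xv_le0 x_ge0.
  rewrite mulr0 sumr_ge0 // => f /edgesP[a [b [eab ->]]].
  have := xw _ _ eab; have := xw b a; rewrite e_sym setUC => /(_ eab).
  lra.
(* Remove the lowest layer, whose height is the least positive value of x. *)
case: (@arg_minP _ _ _ v (fun y => 0 < x y) x xv_gt0) => z /= z_gt0 z_min.
pose A := [set y | x y <= 0].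
pose x' y := if y \in A then 0 else x y - x z.
pose w' f := w f - (if f \in cut A then x z else 0).
have xA0 y : y \in A -> x y = 0.
  by rewrite inE => yA; apply/le_anti; rewrite yA x_ge0.
have x_ge_z y : y \notin A -> x z <= x y by rewrite inE -ltNge; apply: z_min.
have uA : u \in A by rewrite inE xu0.
have vA : v \notin A by rewrite inE -ltNge.
have : k%:R * x' v <= \sum_(f in edges e) w' f.
  apply: IHn => [|y||a b eab].
  - rewrite ltnS in ltn; apply: leq_trans ltn; apply: proper_card.
    apply/properP; split.
      apply/subsetP => y; rewrite !inE /x'; case: ifPn => [_|yA _].
        by rewrite ltxx.
      exact: lt_le_trans z_gt0 (x_ge_z _ yA).
    by exists z; rewrite !inE // /x' inE leNgt z_gt0 /= subrr ltxx.
  - by rewrite /x'; case: ifPn => // yA; rewrite subr_ge0 x_ge_z.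
  - by rewrite /x' uA.
  - have := xw _ _ eab; rewrite /w' mem_cut // /x'.
    have [aA|aA] := boolP (a \in A); have [bA|bA] := boolP (b \in A) => /=.
    + by rewrite (xA0 _ aA) (xA0 _ bA); lra.
    + by rewrite (xA0 _ aA); lra.
    + have := xw b a; rewrite e_sym setUC => /(_ eab).
      by have := x_ge_z _ aA; rewrite (xA0 _ bA); lra.
    + by lra.
rewrite /x' (negbTE vA) /w' sumrB.
have -> : \sum_(f in edges e) (if f \in cut A then x z else 0)
            = #|cut A|%:R * x z.
  rewrite -big_mkcondr /= (eq_bigl (mem (cut A))) => [|f /=].
    by rewrite sumr_const mulr_natl.
  by rewrite [f \in cut A]inE andbA andbb.
have : k%:R * x z <= #|cut A|%:R * x z.
  by rewrite ler_wpM2r ?x_ge0 // ler_nat (cut_ge A).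
lra.
Qed.

End Cuts.

Section Distances.
Variables (R : realFieldType) (T : finType) (e : rel T) (w : {set T} -> R).
Hypothesis w_ge0 : weight_function e w.

Lemma path_weight_cat u p q :
  path_weight w u (p ++ q) = path_weight w u p + path_weight w (last u p) q.
Proof. by rewrite /path_weight /path_edges pairmap_cat big_cat. Qed.

Lemma path_weight_ge0 u p : path e u p -> 0 <= path_weight w u p.
Proof.
elim: p u => [|a p IHp] u; first by rewrite /path_weight big_nil.
move=> /= /andP[ua pa]; rewrite /path_weight /= big_cons addr_ge0 //.
  exact/w_ge0/mem_edges.
exact: IHp.
Qed.

Lemma wdist_le u v p : is_path e u v p -> wdist e w u v <= path_weight w u p.
Proof. by move=> uvp; apply/seq_min_le/map_f; rewrite mem_paths. Qed.

Hypothesis e_conn : connected e.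

Lemma wdist_path u v :
  exists2 p, is_path e u v p & wdist e w u v = path_weight w u p.
Proof.
suff /seq_min_mem/mapP[p] : [seq path_weight w u p | p <- paths e u v] != [::].
  by rewrite mem_paths; exists p.
case/andP: e_conn => _ /forallP/(_ u)/forallP/(_ v)/connectP[p up ->].
case/shortenP: up => q uq Uq _.
have : q \in paths e u (last u q) by rewrite mem_paths /is_path uq Uq eqxx.
by case: (paths _ _ _).
Qed.

Lemma wdist_ge0 u v : 0 <= wdist e w u v.
Proof.
by have [p /and3P[up _ _] ->] := wdist_path u v; apply: path_weight_ge0.
Qed.

Lemma wdist_self u : wdist e w u u = 0.
Proof.
apply/le_anti; rewrite wdist_ge0 andbT.
have /wdist_le : is_path e u u [::] by rewrite /is_path /= eqxx.
by rewrite /path_weight big_nil.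
Qed.

Lemma wdist_step u a b :
  e a b -> wdist e w u b - wdist e w u a <= w [set a; b].
Proof.
move=> eab; rewrite lerBlDl.
have [p /and3P[up Up /eqP lp] ->] := wdist_path u a.
have wab : 0 <= w [set a; b] by apply/w_ge0/mem_edges.
(* If b already lies on a shortest path to a, its initial segment ending at b
   is short enough; otherwise the path extends by the edge ab. *)
have [bp|bp] := boolP (b \in u :: p).
  case/splitPl: bp up Up lp => p1 p2 lp1.
  rewrite cat_path -cat_cons cat_uniq path_weight_cat.
  move=> /andP[up1 p1p2] /andP[Up1 _] _.
  have /wdist_le : is_path e u b p1 by rewrite /is_path up1 Up1 lp1 eqxx.
  have := path_weight_ge0 p1p2; lra.
have /wdist_le : is_path e u b (rcons p b).
  by rewrite /is_path rcons_path up lp eab last_rcons eqxx -rcons_cons rcons_uniq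
    bp Up.
by rewrite -cats1 path_weight_cat lp {2}/path_weight /= big_seq1.
Qed.

Hypothesis e_sym : symmetric e.
Hypothesis w_norm : normalised e w.

Lemma wdist_le_ratio u v :
  wdist e w u v <= #|edges e|%:R / (edge_connectivity e)%:R.
Proof.
have [->|uv] := eqVneq u v.
  by rewrite wdist_self divr_ge0 ?ler0n.
rewrite ler_pdivlMr ?ltr0n ?(edge_connectivity_gt0 e_conn uv) // mulrC -w_norm.
apply: (potential_bound e_sym (u := u)) => [A uA vA|y||a b].
- exact: edge_connectivity_le_cut uA vA.
- exact: wdist_ge0.
- exact: wdist_self.
- exact: wdist_step.
Qed.

Lemma wecc_ge0 v : 0 <= wecc e w v.
Proof. by rewrite -(wdist_self v); apply: (le_bigmax _ (fun u => wdist e w u v)). Qed.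

Lemma avec_ge0 : 0 <= avec e w.
Proof.
by rewrite mulr_ge0 ?invr_ge0 ?ler0n ?sumr_ge0 // => v _; apply: wecc_ge0.
Qed.

Lemma avec_le_ratio : avec e w <= #|edges e|%:R / (edge_connectivity e)%:R.
Proof.
have T_gt0 : (0 : R) < #|T|%:R by rewrite ltr0n; case/andP: e_conn.
rewrite /avec ler_pdivrMl // [#|T|%:R * _]mulr_natl -sumr_const ler_sum // => v _.
by apply: bigmax_le => [|u _]; apply: wdist_le_ratio.
Qed.

End Distances.

Theorem corollary3p6 (R : realType) (T : finType) (e : rel T)
    (w w' : {set T} -> R)
    (e_sym : symmetric e) (e_irr : irreflexive e)
    (e_conn : connected e) (ec_conn : connected (complement e))
    (e_ntree : ~ tree e) (ec_ntree : ~ tree (complement e))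
    (w_ge0 : weight_function e w) (w_norm : normalised e w)
    (w'_ge0 : weight_function (complement e) w')
    (w'_norm : normalised (complement e) w') :
  let m : R := #|edges e|%:R in
  let m' : R := #|edges (complement e)|%:R in
  let l : R := (edge_connectivity e)%:R in
  let l' : R := (edge_connectivity (complement e))%:R in
  (0 <= avec e w + avec (complement e) w' <= m / l + m' / l') /\
  (0 <= avec e w * avec (complement e) w' <= (m * m') / (l * l')).
Proof.
move=> m m' l l'.
have c_sym : symmetric (complement e).
  by move=> x y; rewrite /complement /= eq_sym e_sym.
have a_ge0 := avec_ge0 w_ge0 e_conn.
have a'_ge0 := avec_ge0 w'_ge0 ec_conn.
have a_le := avec_le_ratio w_ge0 e_conn e_sym w_norm.
have a'_le := avec_le_ratio w'_ge0 ec_conn c_sym w'_norm.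
by rewrite addr_ge0 // mulr_ge0 // lerD //= -mulf_div ler_pM.
Qed.
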